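(* Let $b'\in\mathbb C\setminus\{0\}$ and let $h=b'U$ be the operator on $\mathbb C^2\otimes\mathbb C^2$ with $$U=\begin{pmatrix}0&1&1&1\\0&1&1&0\\0&1&1&0\\0&0&0&0\end{pmatrix}.$$ Let $\mathcal D=[h_{12}+h_{23},[h_{12},h_{23}]]$, an operator on $\mathbb C^2\otimes\mathbb C^2\otimes\mathbb C^2$. Then there is no operator $K$ on $\mathbb C^2\otimes\mathbb C^2$ (an arbitrary complex $4\times4$ matrix) such that $$\mathcal D=K_{23}-K_{12}.$$
   Context: Matrices on $\mathbb C^2\otimes\mathbb C^2$ are written in the ordered basis $|00\rangle,|01\rangle,|10\rangle,|11\rangle$. For an operator $O$ on $\mathbb C^2\otimes\mathbb C^2$, $O_{12}=O\otimes\mathbf 1$ and $O_{23}=\mathbf 1\otimes O$ are operators on $(\mathbb C^2)^{\otimes3}$. $[\cdot,\cdot]$ is the commutator. *)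

(* Defs.v *)
From mathcomp Require Import all_boot all_order all_algebra.
From mathcomp Require Import reals.
From mathcomp Require Export mxtens complex.

Set Implicit Arguments.
Unset Strict Implicit.
Unset Printing Implicit Defensive.

Import GRing.Theory.
Local Open Scope ring_scope.

(* Via [mxtens_index], the product index of (i, j) is 2 * i + j, so the basis
   of C^2 (x) C^2 is ordered |00>, |01>, |10>, |11>. *)

Section Operators.

Variable R : realType.

Definition Umx : 'M[R[i]]_(2 * 2) :=
  \matrix_(i, j) nth 0 (nth [::] [:: [:: 0; 1; 1; 1];
                                     [:: 0; 1; 1; 0];
                                     [:: 0; 1; 1; 0];
                                     [:: 0; 0; 0; 0]] i) j.

Definition op12 (O : 'M[R[i]]_(2 * 2)) : 'M[R[i]]_(2 * 2 * 2) :=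
  O *t (1%:M : 'M_2).

(* The tensor product has dimension 2 * (2 * 2), which is convertible to
   2 * 2 * 2, and both bracketings number the basis vector |ijk> as
   4 * i + 2 * j + k: no cast is needed. *)
Definition op23 (O : 'M[R[i]]_(2 * 2)) : 'M[R[i]]_(2 * 2 * 2) :=
  (1%:M : 'M_2) *t O.

Definition commmx n (A B : 'M[R[i]]_n) : 'M[R[i]]_n := A *m B - B *m A.

End Operators.

(* Main.v *)
Require Import Defs.
From mathcomp Require Import all_boot all_order all_algebra.
From mathcomp Require Import reals.
From mathcomp Require Import ring.
Import GRing.Theory Num.Theory.

Local Open Scope ring_scope.

(* Write h = b' U. The matrix entry <001| . |110> vanishes on every K_23 (the
   first spin differs) and on every K_12 (the third spin differs), whereas it
   equals 4 b'^3 on the double commutator. *)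

(** Arithmetic in [R[i]] does not reduce, [R] being abstract. Entries given by a function on natural
    numbers turn each entry of a product of concrete matrices into a closed term that can be
    evaluated. *)
Definition natmx (S : pzSemiRingType) n (f : nat -> nat -> nat) : 'M[S]_n :=
  \matrix_(i, j) (f i j)%:R.

Definition nat_mulmx n (f g : nat -> nat -> nat) (i j : nat) : nat :=
  sumn [seq (f i k * g k j)%N | k <- index_iota 0 n].

Lemma natmx_mul (S : pzSemiRingType) n f g :
  natmx S n f *m natmx S n g = natmx S n (nat_mulmx n f g).
Proof.
apply/matrixP => i j; rewrite !mxE /nat_mulmx sumnE big_map natr_sum big_mkord.
by apply: eq_bigr => k _; rewrite !mxE natrM.
Qed.

Definition Unat (i j : nat) : nat :=
  nth 0%N (nth [::] [:: [:: 0; 1; 1; 1]; [:: 0; 1; 1; 0]; [:: 0; 1; 1; 0];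
                        [:: 0; 0; 0; 0]]%N i) j.

(** Since |abc> has index 4a + 2b + c, division by 2 splits off the third spin; in [U23nat],
    division by 4 splits off the first. *)
Definition U12nat (i j : nat) : nat :=
  (Unat (i %/ 2) (j %/ 2) * (i %% 2 == j %% 2))%N.

Definition U23nat (i j : nat) : nat :=
  ((i %/ 4 == j %/ 4) * Unat (i %% 4) (j %% 4))%N.

Lemma commmxZ (R : realType) n (a b : R[i]) (A B : 'M[R[i]]_n) :
  commmx (a *: A) (b *: B) = (a * b) *: commmx A B.
Proof.
by rewrite /commmx -!scalemxAl -!scalemxAr !scalerA (mulrC b) -scalerBr.
Qed.

Lemma op12Z (R : realType) (a : R[i]) O : op12 (a *: O) = a *: op12 O.
Proof. by apply/matrixP => i j; rewrite !mxE mulrA. Qed.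

Lemma op23Z (R : realType) (a : R[i]) O : op23 (a *: O) = a *: op23 O.
Proof. by apply/matrixP => i j; rewrite !mxE mulrCA. Qed.

Lemma Umx_nat (R : realType) : Umx R = natmx R[i] (2 * 2) Unat.
Proof.
apply/matrixP => i j; rewrite !mxE.
by case: i => [[|[|[|[|i]]]] ?] //; case: j => [[|[|[|[|j]]]] ?].
Qed.

Lemma op12_Umx (R : realType) : op12 (Umx R) = natmx R[i] (2 * 2 * 2) U12nat.
Proof. by apply/matrixP => i j; rewrite Umx_nat !mxE -natrM. Qed.

Lemma op23_Umx (R : realType) : op23 (Umx R) = natmx R[i] (2 * 2 * 2) U23nat.
Proof. by apply/matrixP => i j; rewrite Umx_nat !mxE -natrM. Qed.

Definition v001 : 'I_(2 * 2 * 2) := @Ordinal (2 * 2 * 2) 1 isT.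
Definition v110 : 'I_(2 * 2 * 2) := @Ordinal (2 * 2 * 2) 6 isT.

Lemma op12_entry0 (R : realType) (K : 'M[R[i]]_(2 * 2)) : op12 K v001 v110 = 0.
Proof. by rewrite !mxE mulr0. Qed.

Lemma op23_entry0 (R : realType) (K : 'M[R[i]]_(2 * 2)) : op23 K v001 v110 = 0.
Proof. by rewrite !mxE mul0r. Qed.

Lemma double_commutator_entry (R : realType) :
  commmx (op12 (Umx R) + op23 (Umx R))
    (commmx (op12 (Umx R)) (op23 (Umx R))) v001 v110 = 4.
Proof.
have entry f : natmx R[i] (2 * 2 * 2) f v001 v110 = (f 1 6)%N%:R by rewrite mxE.
have addE (A B : 'M[R[i]]_(2 * 2 * 2)) :
  (A + B) v001 v110 = A v001 v110 + B v001 v110 by rewrite mxE.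
have oppE (A : 'M[R[i]]_(2 * 2 * 2)) :
  (- A) v001 v110 = - A v001 v110 by rewrite mxE.
(* The double commutator expands into eight signed triple products. The signs stay in [R[i]],
   because subtraction of natural numbers truncates; only the products pass to [nat_mulmx]. *)
rewrite /commmx op12_Umx op23_Umx !(mulmxDl, mulmxDr, mulmxN, mulNmx).
rewrite !natmx_mul !(addE, oppE, entry).
(* Each remaining entry is a closed natural number: it is evaluated and replaced by its value, which
   leaves an identity between numerals. *)
do ![match goal with |- context [nat_mulmx ?n ?f ?g 1%N 6%N] =>
  let t := constr:(nat_mulmx n f g 1%N 6%N) in
  let v := eval vm_compute in t in
  have -> : t = v by vm_compute end].
by ring.
Qed.

Theorem proposition1 (R : realType) (b' : R[i]) (hb' : b' <> 0) :
  let h : 'M[R[i]]_(2 * 2) := b' *: Umx R in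
  let D : 'M[R[i]]_(2 * 2 * 2) :=
    commmx (op12 h + op23 h) (commmx (op12 h) (op23 h)) in
  ~ exists K : 'M[R[i]]_(2 * 2), D = op23 K - op12 K.
Proof.
move=> h D [K /matrixP /(_ v001 v110)].
have -> : (op23 K - op12 K) v001 v110 = 0.
  by rewrite mxE op23_entry0 mxE op12_entry0 subrr.
(* The double commutator is homogeneous of degree 3 in h, so b'^3 factors out. What remains to
   refute is b'^3 * 4 = 0, in a field of characteristic zero. *)
rewrite /D /h op12Z op23Z -scalerDr !commmxZ mxE double_commutator_entry.
by move/eqP; rewrite !mulf_eq0 (introF eqP hb') pnatr_eq0.
Qed.
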